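(* For every $n\in\mathbb N$ there exists a weighted 2-complex $C_n$ such that $G(C_n)=GV\!P_n$, and for all $n,k\in\mathbb N$ there exists a weighted 2-complex $C_{n,k}$ such that $G(C_{n,k})=G_n^k$ (equality meaning isomorphism of groups).
   Context: $\mathbb N$ denotes the positive integers. The group $GV\!P_n$ has generators $\lambda_{i,j}$, $1\le i<j\le n$, and relations $\lambda_{i,j}^2=1$, $\lambda_{i,j}\lambda_{k,l}=\lambda_{k,l}\lambda_{i,j}$, $\lambda_{k,i}\lambda_{k,j}\lambda_{i,j}=\lambda_{i,j}\lambda_{k,j}\lambda_{k,i}$, where $i,j,k,l$ denote pairwise distinct indices (for which the symbols occurring are generators). For $n,k\in\mathbb N$ let $[n]=\{1,\dots,n\}$ and $[n]^k=\{\rho\subseteq[n]:|\rho|=k\}$. The group $G_n^k$ has generating set $[n]^k$ and relations: $\rho^2=1$ for $\rho\in[n]^k$; $\rho_1\rho_2=\rho_2\rho_1$ for $\rho_1,\rho_2\in[n]^k$ with $|\rho_1\cap\rho_2|<k-1$; and $\rho_{\sigma(1)}\cdots\rho_{\sigma(k+1)}=\rho_{\sigma(k+1)}\cdots\rho_{\sigma(1)}$ for all $U=\{u_1,\dots,u_{k+1}\}\in[n]^{k+1}$ and all permutations $\sigma\in S_{k+1}$, where $\rho_j=U\setminus\{u_j\}$. Graphs. A graph is a tuple $\Gamma=(V\sqcup E,\iota,\alpha,\omega)$ where $V,E$ are disjoint sets (vertices and edges), $\iota:V\sqcup E\to V\sqcup E$ and $\alpha,\omega:V\sqcup E\to V$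 are maps with $V=\mathrm{Fix}(\iota)$, $\iota\circ\iota=\mathrm{id}$, $\alpha\circ\alpha=\alpha$, $\alpha\circ\iota=\omega$, and $\alpha(v)=\omega(v)=v$ for $v\in V$. Write $e^{-1}=\iota(e)$. Graphs are assumed to have no loops (edges $e$ with $\alpha(e)=\omega(e)$) and no multiple edges (distinct edges with the same $\alpha$ and the same $\omega$). A subgraph is given by a subset $U\subseteq V\sqcup E$ closed under $\iota,\alpha,\omega$, with the restricted maps. For $t\in\mathbb N$, a cycle of length $t$ is a subgraph with $U=\{v_i,e_i,e_i^{-1}\}_{i=1}^t$, $v_i\in V$, $e_i\in E$, such that $\omega(e_i)=\alpha(e_{i+1})=v_{i+1}$ for $1\le i<t$ and $\omega(e_t)=\alpha(e_1)=v_1$; it is denoted $[e_1,\dots,e_t]$. For $v\in V$, the subgraph on $\{v\}$ is a cycle of length zero, denoted $[v]$. $\mathrm{Cyc}(\Gamma)$ is the set of all cycles of all lengths. 2-complexes. A 2-complex is a tuple $K=(V\sqcup E\sqcup F,\iota,\alpha,\omega,\partial)$ where $\Gamma=(V\sqcup E,\iota,\alpha,\omega)$ is a graph, $F$ is a set (of 2-cells) disjoint from $V\sqcup E$, and $\partial:V\sqcup F\to\mathrm{Cyc}(\Gamma)$ is a map such that $\partial(x)$ has length zero if and only if $x\in V$, with $\partial(v)=[v]$ for $v\in V$. The boundary of every 2-cell is assumed to have length at least $3$, and distinct 2-cells have distinct boundaries. A weighted 2-complex is a pair $C=(K,\mu)$ with $K$ a 2-complex and $\mu:V\sqcup E\sqcup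 F\to\mathbb N\cup\{\infty\}$ such that $\mu(x)=1$ iff $x\in V$, and $\mu(x)=\infty$ implies $x\in E$. Generalized Coxeter group. For a weighted 2-complex $C$, $G(C)$ is the group with generating set $V$ and relations: $v^2=1$ for $v\in V$; $(\alpha(e)\omega(e))^{\mu(e)}=1$ for $e\in E$ (no relation if $\mu(e)=\infty$); $(\alpha(e_1)\cdots\alpha(e_t))^{\mu(f)}=1$ for each $f\in F$ with $\partial(f)=[e_1,\dots,e_t]$. *)

(* Defs.v *)
(* MathComp, with classical sets and classical quotients. *)
From HB Require Import structures.
From mathcomp Require Import all_boot perm generic_quotient.
From mathcomp Require Import boolp classical_sets.

Set Implicit Arguments.
Unset Strict Implicit.
Unset Printing Implicit Defensive.

Local Open Scope quotient_scope.

Definition isomorphic (G H : groupType) : Prop :=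
  exists f : {multiplicative G -> H}, bijective f.

Section Presentation.
Variable X : Type.

(* (x, true) stands for the generator x and (x, false) for its inverse. *)
Definition word : Type := {classic seq (X * bool)}.
HB.instance Definition _ := Choice.on word.

Definition wcat (u v : word) : word := (u ++ v)%SEQ.
Definition winv (u : word) : word := rev [seq (p.1, ~~ p.2) | p <- u].

Definition wpos (s : seq X) : word := [seq (x, true) | x <- s].

(* R u v is read as the defining relation u = v. *)
Variable R : word -> word -> Prop.

Inductive pres_eq : word -> word -> Prop :=
| pres_eq_refl u : pres_eq u u
| pres_eq_sym u v : pres_eq u v -> pres_eq v u
| pres_eq_trans u v w : pres_eq u v -> pres_eq v w -> pres_eq u w
| pres_eq_cat u u' v v' :
    pres_eq u u' -> pres_eq v v' -> pres_eq (wcat u v) (wcat u' v')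
| pres_eq_cancel (x : X) (b : bool) : pres_eq [:: (x, b); (x, ~~ b)] [::]
| pres_eq_rel u v : R u v -> pres_eq u v.

Definition pres_eqb (u v : word) : bool := `[< pres_eq u v >].

Lemma pres_eqb_refl : reflexive pres_eqb.
Proof. by move=> u; apply/asboolP; exact: pres_eq_refl. Qed.

Lemma pres_eqb_sym : symmetric pres_eqb.
Proof. by move=> u v; apply/asboolP/asboolP; exact: pres_eq_sym. Qed.

Lemma pres_eqb_trans : transitive pres_eqb.
Proof.
move=> v u w /asboolP uv /asboolP vw; apply/asboolP.
exact: pres_eq_trans uv vw.
Qed.

Canonical pres_equiv :=
  EquivRel pres_eqb pres_eqb_refl pres_eqb_sym pres_eqb_trans.

(* The group < X | R >. *)
Definition presented : Type := {eq_quot pres_equiv}.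
HB.instance Definition _ := Choice.on presented.
HB.instance Definition _ := EqQuotient.on presented.

Lemma presentedP (u v : word) :
  \pi_presented u = \pi_presented v <-> pres_eq u v.
Proof.
split=> [/eqmodP /asboolP //|uv].
by apply/eqmodP; apply/asboolP.
Qed.

Lemma pres_repr (u : word) : pres_eq (repr (\pi_presented u)) u.
Proof. by apply/presentedP; rewrite reprK. Qed.

Lemma pres_eq_winvl (u : word) : pres_eq (wcat (winv u) u) [::].
Proof.
elim: u => [|[x b] u IHu]; first exact: pres_eq_refl.
rewrite /winv map_cons rev_cons -cats1 /wcat -catA cat_cons cat0s /=.
apply: (pres_eq_trans _ IHu); apply: pres_eq_cat; first exact: pres_eq_refl.
rewrite -[_ :: _ :: u]/(wcat [:: (x, ~~ b); (x, b)] u) -{2}[u]/(wcat [::] u).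
apply: pres_eq_cat; last exact: pres_eq_refl.
by rewrite -{2}[b]negbK; exact: pres_eq_cancel.
Qed.

Lemma winvK : involutive winv.
Proof.
move=> u; rewrite /winv map_rev revK -map_comp -[RHS]map_id.
by apply: eq_map => -[x b] /=; rewrite negbK.
Qed.

Lemma pres_eq_winvr (u : word) : pres_eq (wcat u (winv u)) [::].
Proof. by have := pres_eq_winvl (winv u); rewrite winvK. Qed.

Definition pres_one : presented := \pi_presented ([::] : word).
Definition pres_mul (a b : presented) : presented :=
  \pi_presented (wcat (repr a) (repr b)).
Definition pres_inv (a : presented) : presented :=
  \pi_presented (winv (repr a)).

Lemma pres_mulA : associative pres_mul.
Proof.
move=> a b c; apply/presentedP.
apply: (@pres_eq_trans _ (wcat (repr a) (wcat (repr b) (repr c)))).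
  by apply: pres_eq_cat (pres_eq_refl _) (pres_repr _).
rewrite /wcat catA; apply: pres_eq_sym.
exact: pres_eq_cat (pres_repr _) (pres_eq_refl _).
Qed.

Lemma pres_mul1 : left_id pres_one pres_mul.
Proof.
move=> a; rewrite -[RHS]reprK; apply/presentedP.
exact: pres_eq_cat (pres_repr _) (pres_eq_refl _).
Qed.

Lemma pres_mulr1 : right_id pres_one pres_mul.
Proof.
move=> a; rewrite -[RHS]reprK; apply/presentedP; rewrite -[X in pres_eq _ X]cats0.
exact: pres_eq_cat (pres_eq_refl _) (pres_repr _).
Qed.

Lemma pres_mulV : left_inverse pres_one pres_inv pres_mul.
Proof.
move=> a; apply/presentedP; apply: pres_eq_trans (pres_eq_winvl (repr a)).
exact: pres_eq_cat (pres_repr _) (pres_eq_refl _).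
Qed.

Lemma pres_mulrV : right_inverse pres_one pres_inv pres_mul.
Proof.
move=> a; apply/presentedP; apply: pres_eq_trans (pres_eq_winvr (repr a)).
exact: pres_eq_cat (pres_eq_refl _) (pres_repr _).
Qed.

HB.instance Definition _ :=
  isGroup.Build presented pres_mulA pres_mul1 pres_mulr1 pres_mulV pres_mulrV.

End Presentation.

(* The index set {1, ..., n} is encoded as 'I_n. *)

Section GVP.
Variable n : nat.

Definition gvp_gen : Type := {p : 'I_n * 'I_n | p.1 < p.2}.

Definition lambda (i j : 'I_n) (lt_ij : i < j) : gvp_gen :=
  exist (fun p : 'I_n * 'I_n => p.1 < p.2) (i, j) lt_ij.

Inductive gvp_rel : word gvp_gen -> word gvp_gen -> Prop :=
| gvp_sq (i j : 'I_n) (ij : i < j) :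
    gvp_rel (wpos [:: lambda ij; lambda ij]) (wpos [::])
| gvp_comm (i j k l : 'I_n) (ij : i < j) (kl : k < l) : uniq [:: i; j; k; l] ->
    gvp_rel (wpos [:: lambda ij; lambda kl]) (wpos [:: lambda kl; lambda ij])
| gvp_braid (i j k : 'I_n) (ki : k < i) (kj : k < j) (ij : i < j) :
    gvp_rel (wpos [:: lambda ki; lambda kj; lambda ij])
            (wpos [:: lambda ij; lambda kj; lambda ki]).

Definition GVP : groupType := presented gvp_rel.

End GVP.

Section Gnk.
Variables n k : nat.

Definition gnk_gen : Type := {r : {set 'I_n} | #|r| == k}.

Inductive gnk_rel : word gnk_gen -> word gnk_gen -> Prop :=
| gnk_sq (r : gnk_gen) : gnk_rel (wpos [:: r; r]) (wpos [::])
| gnk_comm (r1 r2 : gnk_gen) : #|sval r1 :&: sval r2| < k.-1 ->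
    gnk_rel (wpos [:: r1; r2]) (wpos [:: r2; r1])
| gnk_rev (U : {set 'I_n}) (u : 'I_k.+1 -> 'I_n) (r : 'I_k.+1 -> gnk_gen)
    (s : {perm 'I_k.+1}) :
    #|U| = k.+1 -> U = [set u j | j : 'I_k.+1] ->
    (forall j, sval (r j) = U :\ u j) ->
    gnk_rel (wpos [seq r (s i) | i <- enum 'I_k.+1])
            (wpos (rev [seq r (s i) | i <- enum 'I_k.+1])).

Definition Gnk : groupType := presented gnk_rel.

End Gnk.

(* inl and inr stand for the inclusions of the two sides of a disjoint union. *)
Record graph := Graph {
  vertex : Type;
  edge : Type;
  iota_ : vertex + edge -> vertex + edge;
  alpha : vertex + edge -> vertex;
  omega : vertex + edge -> vertex;
  fix_iota : forall x, iota_ x = x <-> exists v, x = inl v;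
  iota_K : forall x, iota_ (iota_ x) = x;
  alpha_alpha : forall x, alpha (inl (alpha x)) = alpha x;
  alpha_iota : forall x, alpha (iota_ x) = omega x;
  alpha_vertex : forall v, alpha (inl v) = v;
  omega_vertex : forall v, omega (inl v) = v;
  no_loop : forall e, alpha (inr e) <> omega (inr e);
  no_multiple_edge : forall e e',
    alpha (inr e) = alpha (inr e') -> omega (inr e) = omega (inr e') -> e = e'
}.

Section Cycles.
Variable K : graph.

Definition subgraph (U : set (vertex K + edge K)) : Prop :=
  forall x, U x -> [/\ U (iota_ x), U (inl (alpha x)) & U (inl (omega x))].

(* U = [e_1, ..., e_t] with t >= 1; indices are cyclic, ordS being the cyclic *)
(* successor, and v_i is alpha (e_i).  The vertices v_1, ..., v_t are pairwise *)
(* distinct: otherwise U would not determine t, nor the relator attached to a *)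
(* 2-cell with boundary U.                                                    *)
Definition traverses (t : nat) (e : 'I_t -> edge K)
    (U : set (vertex K + edge K)) : Prop :=
  [/\ 0 < t,
      subgraph U,
      U = [set x | exists i : 'I_t, [\/ x = inl (alpha (inr (e i))),
                                       x = inr (e i)
                                     | x = iota_ (inr (e i))]]%classic,
      injective (fun i => alpha (inr (e i)))
    & forall i, omega (inr (e i)) = alpha (inr (e (ordS i)))].

Definition is_cycle (t : nat) (U : set (vertex K + edge K)) : Prop :=
  if t is 0 then exists v, U = [set inl v]%classic
  else exists e : 'I_t -> edge K, traverses e U.

Definition Cyc : set (set (vertex K + edge K)) :=
  [set U | exists t, is_cycle t U]%classic.

End Cycles.

Record complex2 := Complex2 {
  skeleton :> graph;
  face : Type;
  boundary : vertex skeleton + face -> set (vertex skeleton + edge skeleton);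
  boundary_cycle : forall x, Cyc (boundary x);
  boundary_length0 : forall x, is_cycle 0 (boundary x) <-> exists v, x = inl v;
  boundary_vertex : forall v, boundary (inl v) = [set inl v]%classic;
  boundary_length_ge3 : forall f t, is_cycle t (boundary (inr f)) -> 3 <= t;
  boundary_face_inj : forall f f',
    boundary (inr f) = boundary (inr f') -> f = f'
}.

(* A weight Some m is the positive integer m, and None is infinity. *)
Record weighted_complex2 := WeightedComplex2 {
  complex2_of :> complex2;
  mu : vertex complex2_of + edge complex2_of + face complex2_of -> option nat;
  mu_gt0 : forall x m, mu x = Some m -> 0 < m;
  mu_eq1 : forall x, mu x = Some 1 <-> exists v, x = inl (inl v);
  mu_infty : forall x, mu x = None -> exists e, x = inl (inr e)
}.

Section GeneralizedCoxeter.
Variable C : weighted_complex2.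

Definition wpow (s : seq (vertex C)) (m : nat) : word (vertex C) :=
  wpos (flatten (nseq m s)).

(* In coxeter_face every way of writing the boundary of f as [e_1, ..., e_t]  *)
(* contributes a relator; given the relations v^2 = 1, these are conjugate up *)
(* to inversion, so that any one of them implies the others.                  *)
Inductive coxeter_rel : word (vertex C) -> word (vertex C) -> Prop :=
| coxeter_vertex (v : vertex C) : coxeter_rel (wpos [:: v; v]) (wpos [::])
| coxeter_edge (e : edge C) (m : nat) : mu (inl (inr e)) = Some m ->
    coxeter_rel (wpow [:: alpha (inr e); omega (inr e)] m) (wpos [::])
| coxeter_face (f : face C) (t : nat) (e : 'I_t -> edge C) (m : nat) :
    traverses e (boundary (inr f)) -> mu (inr f) = Some m ->
    coxeter_rel (wpow [seq alpha (inr (e i)) | i <- enum 'I_t] m) (wpos [::]).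

Definition coxeter_group : groupType := presented coxeter_rel.

End GeneralizedCoxeter.

(* Main.v *)
Require Import Defs.
From HB Require Import structures.
From mathcomp Require Import all_boot perm generic_quotient.
From mathcomp Require Import boolp classical_sets.

(** If [x_1, ..., x_t] are involutions, [(x_1 ... x_t)^2 = 1] says exactly
    that [x_1 ... x_t = x_t ... x_1], because the reversed word is the inverse
    ([reversibleP]).  Both families of groups are presented by involutions
    together with relations of this second kind: a commutation [ab = ba] is the
    case [t = 2], and the remaining relations reverse words in distinct
    generators.  So every relator is a square, and the complex has only to
    record which words are squared: each pair of generators that must commute
    becomes an edge of weight 2, each longer word a 2-cell of weight 2, and all
    other edges of the complete graph on the generators get weight infinity.

    A 2-cell remembers only a cycle, as a set of vertices and edges, and not
    the word it came from.  This costs nothing, because in both groups the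
    reversal relation holds for every ordering of a given block of generators:
    two traversals of one cycle visit the same vertices
    ([traverses_perm]), hence both yield consequences of the relations.  In
    [Gnk] all orderings occur among the defining relations.  In [GVP] only one
    ordering of each triple does, but reversible words are closed under
    rotation and reversal, and these generate all six orderings of a triple
    ([perm_triple_dihedral]).

    [block_coxeter_group] is the resulting criterion; the theorem applies it to
    the pairs and triples of [gvp_block], and to the pairs and the sets of
    facets of [gnk_block].  When [k = 1] the sets of facets are themselves
    pairs, and the complex has edges of weight 2 but no 2-cell. *)

Set Implicit Arguments.
Unset Strict Implicit.
Unset Printing Implicit Defensive.

(** * Presentations with the same consequences *)

Section SameRelations.
Variables (X : Type) (R S : word X -> word X -> Prop).
Hypothesis RS : forall u v, R u v -> pres_eq S u v.
Hypothesis SR : forall u v, S u v -> pres_eq R u v.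

Lemma pres_eq_mono (R1 R2 : word X -> word X -> Prop) :
  (forall u v, R1 u v -> pres_eq R2 u v) ->
  forall u v, pres_eq R1 u v -> pres_eq R2 u v.
Proof.
move=> R12 u v; elim=> {u v}; first exact: pres_eq_refl.
- by move=> u v _; exact: pres_eq_sym.
- by move=> u v w _ uv _; exact: pres_eq_trans.
- by move=> u u' v v' _ uu' _; exact: pres_eq_cat.
- exact: pres_eq_cancel.
- exact: R12.
Qed.

Let phi (a : presented R) : presented S := (\pi_(presented S) (repr a))%qT.
Let psi (a : presented S) : presented R := (\pi_(presented R) (repr a))%qT.

Let phiM : {morph phi : a b / (a * b)%g}.
Proof.
move=> a b; apply/presentedP.
apply: (@pres_eq_trans _ _ _ (wcat (repr a) (repr b))).
  exact: pres_eq_mono RS _ _ (pres_repr _ _).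
by apply: pres_eq_sym; apply: pres_eq_cat; exact: pres_repr.
Qed.

HB.instance Definition _ := isMultiplicative.Build _ _ phi phiM.

Lemma presented_isomorphic : isomorphic (presented R) (presented S).
Proof.
exists phi; exists psi => a.
- rewrite -[RHS](@reprK _ (presented R)); apply/presentedP.
  exact: pres_eq_mono SR _ _ (pres_repr _ _).
- rewrite -[RHS](@reprK _ (presented S)); apply/presentedP.
  exact: pres_eq_mono RS _ _ (pres_repr _ _).
Qed.

End SameRelations.

(** * Reversible words in groups generated by involutions *)

Section Involutions.
Variables (X : Type) (R : word X -> word X -> Prop).

Definition reversible (s : seq X) : Prop := pres_eq R (wpos s) (wpos (rev s)).

Lemma wpos_cat (s t : seq X) : wpos (s ++ t) = wcat (wpos s) (wpos t).
Proof. exact: map_cat. Qed.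

Lemma pres_eq_wpos_cat s s' t t' :
  pres_eq R (wpos s) (wpos s') -> pres_eq R (wpos t) (wpos t') ->
  pres_eq R (wpos (s ++ t)) (wpos (s' ++ t')).
Proof. by rewrite !wpos_cat; exact: pres_eq_cat. Qed.

Hypothesis sq1 : forall x, pres_eq R (wpos [:: x; x]) (wpos [::]).

Lemma pres_eq_cat_rev s : pres_eq R (wpos (s ++ rev s)) (wpos [::]).
Proof.
elim: s => [|x s IHs]; first exact: pres_eq_refl.
rewrite rev_cons -cats1 cat_cons catA -cat1s.
apply: pres_eq_trans (sq1 x).
apply: (@pres_eq_wpos_cat [:: x] [:: x]); first exact: pres_eq_refl.
by apply: (@pres_eq_wpos_cat _ [::]) => //; exact: pres_eq_refl.
Qed.

(** Since [s ++ rev s] is trivial, [rev s] represents the inverse of [s]. *)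
Lemma reversibleP s :
  reversible s <-> pres_eq R (wpos (s ++ s)) (wpos [::]).
Proof.
split=> [rs|ss1].
  apply: pres_eq_trans (pres_eq_cat_rev s).
  by apply: pres_eq_wpos_cat => //; exact: pres_eq_refl.
apply: (@pres_eq_trans _ _ _ (wpos (s ++ s ++ rev s))).
  rewrite -{1}[s]cats0; apply: pres_eq_wpos_cat; first exact: pres_eq_refl.
  exact: pres_eq_sym (pres_eq_cat_rev s).
rewrite catA; apply: (@pres_eq_wpos_cat _ [::]) => //; exact: pres_eq_refl.
Qed.

Lemma reversible_rev s : reversible s -> reversible (rev s).
Proof. by rewrite /reversible revK; exact: pres_eq_sym. Qed.

(** The squares of [x :: s] and of its rotation are conjugate by [x]. *)
Lemma reversible_rot1 s : reversible s -> reversible (rot 1 s).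
Proof.
case: s => [|x s] // /reversibleP xsxs1; apply/reversibleP.
rewrite /rot /= drop0 take0.
apply: (@pres_eq_trans _ _ _ (wpos ([:: x] ++ (x :: s ++ x :: s) ++ [:: x]))).
  (* Inserting [x x = 1] in front exposes the square of [x :: s]. *)
  have -> : [:: x] ++ (x :: s ++ x :: s) ++ [:: x]
          = [:: x; x] ++ (s ++ [:: x]) ++ s ++ [:: x] by rewrite /= -!catA.
  apply: (@pres_eq_wpos_cat [::]); last exact: pres_eq_refl.
  exact: pres_eq_sym.
apply: pres_eq_trans (sq1 x).
apply: (@pres_eq_wpos_cat [:: x] [:: x]); first exact: pres_eq_refl.
by apply: (@pres_eq_wpos_cat _ [::]) => //; exact: pres_eq_refl.
Qed.

End Involutions.

Lemma perm_eq_pair (T : eqType) (a b : T) (s : seq T) :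
  perm_eq [:: a; b] s -> s = [:: a; b] \/ s = [:: b; a].
Proof.
move=> abs; have := perm_size abs.
case: s abs => [|x [|y []]] // abs _.
have: x \in [:: a; b] by rewrite (perm_mem abs) mem_head.
rewrite !inE => /orP[] /eqP xE; subst x.
  by left; move: abs; rewrite perm_cons => /perm_small_eq ->.
right; have: perm_eq [:: b; a] [:: b; y] by rewrite (perm_catC [:: b] [:: a]).
by rewrite perm_cons => /perm_small_eq ->.
Qed.

(** The dihedral group of a triangle is the full symmetric group on its three
    vertices: a rotation puts the right element in front, and the reflection
    fixing that element exchanges the other two. *)
Lemma perm_triple_dihedral (T : eqType) (P : seq T -> Prop) (a b c : T) s :
  (forall t, P t -> P (rot 1 t)) -> (forall t, P t -> P (rev t)) ->
  perm_eq [:: a; b; c] s -> P [:: a; b; c] -> P s.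
Proof.
move=> Prot Prev abcs Pabc; have := perm_size abcs.
case: s abcs => [|x t] // abcs _.
have same_head y z : P [:: x; y; z] -> perm_eq [:: x; y; z] (x :: t) -> P (x :: t).
  move=> Pxyz; rewrite perm_cons => /perm_eq_pair[] -> //.
  exact: Prot _ (Prot _ (Prev _ Pxyz)).
have: x \in [:: a; b; c] by rewrite (perm_mem abcs) mem_head.
rewrite !inE => /or3P[] /eqP xE; subst x.
- exact: (same_head b c).
- apply: (same_head c a); first exact: Prot _ Pabc.
  by rewrite (perm_catC [:: b; c] [:: a]).
- apply: (same_head a b); first exact: Prot _ (Prot _ Pabc).
  by rewrite (perm_catC [:: c] [:: a; b]).
Qed.

(** * Cycles in the complete graph *)

Section CompleteGraph.
Variable V : eqType.

Definition arc : Type := {p : V * V | p.1 != p.2}.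

Definition mkarc (x y : V) (xy : x != y) : arc :=
  exist (fun p : V * V => p.1 != p.2) (x, y) xy.

Lemma arc_inv_subproof (e : arc) : (sval e).2 != (sval e).1.
Proof. by rewrite eq_sym (svalP e). Qed.

Definition arc_inv (e : arc) : arc := mkarc (arc_inv_subproof e).

Definition k_iota (x : V + arc) : V + arc :=
  match x with inl v => inl v | inr e => inr (arc_inv e) end.
Definition k_alpha (x : V + arc) : V :=
  match x with inl v => v | inr e => (sval e).1 end.
Definition k_omega (x : V + arc) : V :=
  match x with inl v => v | inr e => (sval e).2 end.

Lemma k_fix_iota x : k_iota x = x <-> exists v, x = inl v.
Proof.
case: x => [v|[[x y] /= xy]]; split=> //; first by exists v.
  by case=> yx; exfalso; move/eqP: (xy); apply.
by case.
Qed.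

Lemma k_iotaK x : k_iota (k_iota x) = x.
Proof. by case: x => [//|[[x y] xy]]; congr inr; exact: val_inj. Qed.

Lemma k_alpha_iota x : k_alpha (k_iota x) = k_omega x.
Proof. by case: x. Qed.

Lemma k_no_loop e : k_alpha (inr e) <> k_omega (inr e).
Proof. by case: e => -[x y] /= /eqP. Qed.

Lemma k_no_multiple_edge e e' :
  k_alpha (inr e) = k_alpha (inr e') -> k_omega (inr e) = k_omega (inr e') ->
  e = e'.
Proof.
by case: e e' => -[x y] xy [[x' y'] xy'] /= xx' yy'; apply: val_inj => /=; congr pair.
Qed.

Definition complete_graph : graph :=
  @Graph V arc k_iota k_alpha k_omega k_fix_iota k_iotaK (fun=> erefl)
    k_alpha_iota (fun=> erefl) (fun=> erefl) k_no_loop k_no_multiple_edge.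

(** For the edges of a cycle, these are the vertices in the order in which the
    cycle visits them: the word whose power is the relator of a 2-cell. *)
Definition edge_starts (t : nat) (e : 'I_t -> edge complete_graph) : seq V :=
  [seq alpha (inr (e i)) | i <- enum 'I_t].

Lemma size_edge_starts t (e : 'I_t -> edge complete_graph) :
  size (edge_starts e) = t.
Proof. by rewrite -[RHS](size_enum_ord t); exact: size_map. Qed.

Lemma traverses_mem t (e : 'I_t -> edge complete_graph) U v :
  traverses e U -> U (inl v) <-> v \in edge_starts e.
Proof.
case=> _ _ -> _ _; split=> [[i [[->]|//|//]]|/mapP[i _ ->]].
  by apply: map_f; rewrite mem_enum.
by exists i; constructor 1.
Qed.

(** The set of vertices on the cycle [U] does not depend on how [U] is run
    through, and a traversal visits each vertex once. *)
Lemma traverses_perm t (e : 'I_t -> edge complete_graph)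
    t' (e' : 'I_t' -> edge complete_graph) U :
  traverses e U -> traverses e' U -> perm_eq (edge_starts e) (edge_starts e').
Proof.
move=> eU e'U; apply: uniq_perm.
- by case: eU => _ _ _ inj _; rewrite map_inj_uniq ?enum_uniq.
- by case: e'U => _ _ _ inj _; rewrite map_inj_uniq ?enum_uniq.
move=> v; apply/idP/idP.
- by move/(traverses_mem v eU)/(traverses_mem v e'U).
- by move/(traverses_mem v e'U)/(traverses_mem v eU).
Qed.

Lemma ordS_neq t (i : 'I_t) : 1 < t -> ordS i != i.
Proof.
case: i => i it t1; rewrite -val_eqE /=.
move: it; rewrite leq_eqVlt => /predU1P[it|it]; last by rewrite modn_small ?gtn_eqF.
by rewrite -it modnn; case: i it t1 => // <-.
Qed.

(** Follow [s] cyclically; consecutive vertices differ, so the complete graph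
    has an edge between them. *)
Lemma exists_traverses (s : seq V) : uniq s -> 1 < size s ->
  exists (e : 'I_(size s) -> edge complete_graph) U,
    edge_starts e = s /\ traverses e U.
Proof.
move=> us s1; have /tuple_uniqP inj : uniq (in_tuple s) by [].
have ne i : tnth (in_tuple s) i != tnth (in_tuple s) (ordS i).
  by rewrite (inj_eq inj) eq_sym ordS_neq.
exists (fun i => mkarc (ne i)).
exists [set x | exists i, [\/ x = inl (tnth (in_tuple s) i),
   x = inr (mkarc (ne i)) | x = inr (arc_inv (mkarc (ne i)))]]%classic; split.
  exact: map_tnth_enum (in_tuple s).
split=> //=; first exact: ltnW.
move=> x [i [|  |]] ->.
- by split; exists i; constructor 1.
- split; [exists i; constructor 3|exists i; constructor 1|] => //.
  by exists (ordS i); constructor 1.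
- split; [exists i; constructor 2|exists (ordS i); constructor 1
         |exists i; constructor 1] => //.
  by congr inr; exact: val_inj.
Qed.

End CompleteGraph.

(** * The weighted 2-complex of a family of blocks *)

Section ReversibleBlocks.
Variables (V : eqType) (block : seq V -> Prop).
Hypothesis block_uniq : forall s, block s -> uniq s.
Hypothesis block_size : forall s, block s -> 1 < size s.

(** A block stands for a finite set of generators, given by one enumeration. *)
Definition ordering (s : seq V) : Prop := exists2 s0, block s0 & perm_eq s0 s.

Lemma ordering_uniq s : ordering s -> uniq s.
Proof. by case=> s0 /block_uniq us0 /perm_uniq <-. Qed.

Lemma ordering_size s : ordering s -> 1 < size s.
Proof. by case=> s0 /block_size us0 /perm_size <-. Qed.

Let K := complete_graph V.

(** A 2-cell is identified with its boundary cycle, so orderings of a block that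
    run through the same cycle give one and the same 2-cell. *)
Definition block_cycle (U : set (vertex K + edge K)) : Prop :=
  exists t (e : 'I_t -> edge K),
    [/\ 2 < t, traverses e U & ordering (edge_starts e)].

Definition block_face : Type := {U | block_cycle U}.

Definition block_boundary (x : vertex K + block_face) :
    set (vertex K + edge K) :=
  match x with inl v => [set inl v]%classic | inr f => sval f end.

Lemma block_boundary_cycle x : Cyc (block_boundary x).
Proof.
case: x => [v|[U cU]]; first by exists 0, v.
have [t [e [t2 eU _]]] := cU; exists t.
by case: t e t2 eU => // t e _ eU; exists e.
Qed.

Lemma block_boundary_length0 x :
  is_cycle 0 (block_boundary x) <-> exists v, x = inl v.
Proof.
case: x => [v|[U cU]]; split=> [|[w] //].
- by exists v.
- by exists v.
have [t [e [t2 eU _]]] := cU; case=> [v /= UE]; exfalso; case: eU => t0 _ UE' _ _.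
have : U (inr (e (Ordinal t0))).
  by rewrite UE'; exists (Ordinal t0); constructor 2.
by rewrite UE.
Qed.

Lemma block_boundary_length_ge3 f t :
  is_cycle t (block_boundary (inr f)) -> 3 <= t.
Proof.
case: t => [/block_boundary_length0[]//|t [e' e'U]].
case: f e'U => U cU /= e'U; have [t' [e [t'2 eU _]]] := cU.
have := perm_size (traverses_perm eU e'U).
by rewrite !size_edge_starts => <-.
Qed.

Lemma block_boundary_face_inj f f' :
  block_boundary (inr f) = block_boundary (inr f') -> f = f'.
Proof.
by case: f f' => U cU [U' cU'] /= UU'; subst U'; congr exist; exact: Prop_irrelevance.
Qed.

Definition block_complex : complex2 :=
  Complex2 block_boundary_cycle block_boundary_length0 (fun=> erefl)
    block_boundary_length_ge3 block_boundary_face_inj.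

Definition block_mu (x : vertex K + edge K + block_face) : option nat :=
  match x with
  | inl (inl _) => Some 1
  | inl (inr e) => if `[< ordering [:: (sval e).1; (sval e).2] >] then Some 2
                   else None
  | inr _ => Some 2
  end.

Lemma block_mu_gt0 x m : block_mu x = Some m -> 0 < m.
Proof. by case: x => [[v|e]|f] /=; [case=> <- | case: ifP => // _ [<-] | case=> <-]. Qed.

Lemma block_mu_eq1 x : block_mu x = Some 1 <-> exists v, x = inl (inl v).
Proof.
by case: x => [[v|e]|f] /=; split=> [|[w] //]; [exists v | case: ifP |].
Qed.

Lemma block_mu_infty x : block_mu x = None -> exists e, x = inl (inr e).
Proof. by case: x => [[v|e]|f] //= _; exists e. Qed.

Definition block_weighted : weighted_complex2 :=
  @WeightedComplex2 block_complex block_mu block_mu_gt0 block_mu_eq1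
    block_mu_infty.

Variable R : word V -> word V -> Prop.
Hypothesis R_sq : forall x, pres_eq R (wpos [:: x; x]) (wpos [::]).
Hypothesis R_block : forall s, ordering s -> reversible R s.
Hypothesis R_sub : forall u v, R u v ->
  (exists x, u = wpos [:: x; x] /\ v = wpos [::]) \/
  (exists s, [/\ ordering s, u = wpos s & v = wpos (rev s)]).

Lemma block_coxeter_sq (x : V) :
  pres_eq (@coxeter_rel block_weighted) (wpos [:: x; x]) (wpos [::]).
Proof. by apply: pres_eq_rel; exact: (@coxeter_vertex block_weighted). Qed.

Lemma wpow2 (s : seq V) : @wpow block_weighted s 2 = wpos (s ++ s).
Proof. by rewrite /wpow /= cats0. Qed.

(** An ordering of length 2 is read off an edge of weight 2, a longer one off
    the 2-cell bounded by the cycle that follows it. *)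
Lemma block_coxeter_reversible s :
  ordering s -> reversible (@coxeter_rel block_weighted) s.
Proof.
move=> bs; apply/(reversibleP block_coxeter_sq); rewrite -wpow2.
have us := ordering_uniq bs.
have := ordering_size bs; rewrite leq_eqVlt => /predU1P[s2|s3].
  case: s bs s2 us => [|a [|b []]] // bs _; rewrite /= inE andbT => ab.
  apply: pres_eq_rel.
  apply: (@coxeter_edge block_weighted (mkarc ab)) => /=.
  by case: asboolP.
have [e [U [es eU]]] := exists_traverses us (ltnW s3).
have cU : block_cycle U by exists (size s), e; split=> //; rewrite es.
apply: pres_eq_rel; rewrite -{1}es.
exact: (@coxeter_face block_weighted (exist _ U cU) _ e 2).
Qed.

(** The relator of a 2-cell may come from another traversal than the one that
    put the cell in the complex, but it still orders the same block. *)
Lemma block_coxeter_sub u v :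
  @coxeter_rel block_weighted u v -> pres_eq R u v.
Proof.
case=> [x|e m|[U cU] t e m eU [<-]]; first exact: R_sq.
  rewrite /=; case: asboolP => // be [<-]; rewrite wpow2.
  by apply/(reversibleP R_sq); exact: R_block.
rewrite wpow2; apply/(reversibleP R_sq); apply: R_block.
have [t' [e' [_ e'U be']]] := cU; rewrite /= in eU.
case: be' => s0 bs0 s0e'; exists s0 => //.
exact: perm_trans s0e' (traverses_perm e'U eU).
Qed.

(** The hypotheses on [R] say that it presents the group generated by
    involutions in which all orderings of all blocks are reversible. *)
Theorem block_coxeter_group :
  isomorphic (coxeter_group block_weighted) (presented R).
Proof.
apply: presented_isomorphic; first exact: block_coxeter_sub.
move=> u v /R_sub[[x [-> ->]]|[s [bs -> ->]]]; first exact: block_coxeter_sq.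
exact: block_coxeter_reversible.
Qed.

End ReversibleBlocks.

(** * The groups GVP *)

Section GVPBlocks.
Variable n : nat.

Inductive gvp_block : seq (gvp_gen n) -> Prop :=
| gvp_block_pair (i j k l : 'I_n) (ij : i < j) (kl : k < l) :
    uniq [:: i; j; k; l] -> gvp_block [:: lambda ij; lambda kl]
| gvp_block_triangle (i j k : 'I_n) (ki : k < i) (kj : k < j) (ij : i < j) :
    gvp_block [:: lambda ki; lambda kj; lambda ij].

Lemma gvp_sq1 x : pres_eq (@gvp_rel n) (wpos [:: x; x]) (wpos [::]).
Proof. by case: x => -[i j] /= ij; apply: pres_eq_rel; exact: gvp_sq. Qed.

Lemma gvp_block_uniq s : gvp_block s -> uniq s.
Proof.
case=> [i j k l ij kl|i j k ki kj ij] /=.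
  rewrite !inE !negb_or => /and4P[/and3P[_ ik _] _ _ _].
  by rewrite andbT -val_eqE /= xpair_eqE negb_and ik.
rewrite !inE andbT -!val_eqE /= !xpair_eqE -!val_eqE /= !negb_or !negb_and.
by rewrite (ltn_eqF ij) (ltn_eqF ki) /= !orbT.
Qed.

Lemma gvp_block_size s : gvp_block s -> 1 < size s.
Proof. by case. Qed.

(** Of the six orderings of a triangle only one is a defining relation; the
    others are its rotations and reversals. *)
Lemma gvp_block_reversible s : ordering gvp_block s -> reversible (@gvp_rel n) s.
Proof.
case=> _ [i j k l ij kl ijkl|i j k ki kj ij] p.
  have rev_ij : reversible (@gvp_rel n) [:: lambda ij; lambda kl].
    by apply: pres_eq_rel; exact: gvp_comm.
  by case: (perm_eq_pair p) => -> //; exact: reversible_rev rev_ij.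
apply: perm_triple_dihedral p _.
- by move=> t; apply: reversible_rot1; exact: gvp_sq1.
- by move=> t; exact: reversible_rev.
by apply: pres_eq_rel; exact: gvp_braid.
Qed.

Lemma gvp_coxeter : exists C, isomorphic (coxeter_group C) (GVP n).
Proof.
exists (block_weighted gvp_block).
apply: block_coxeter_group; [exact: gvp_block_uniq | exact: gvp_block_size
  | exact: gvp_sq1 | exact: gvp_block_reversible |].
move=> u v [i j ij|i j k l ij kl u4|i j k ki kj ij]; [left | right | right].
- by exists (lambda ij).
- exists [:: lambda ij; lambda kl]; split=> //.
  by exists [:: lambda ij; lambda kl] => //; constructor.
- exists [:: lambda ki; lambda kj; lambda ij]; split=> //.
  by exists [:: lambda ki; lambda kj; lambda ij] => //; constructor.
Qed.

End GVPBlocks.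

(** * The groups Gnk *)

Section GnkBlocks.
Variables n k : nat.
Hypothesis k_gt0 : 0 < k.

(** The permutation in the defining relations is absorbed into the choice of
    the enumerations [u] and [r]. *)
Inductive gnk_block : seq (gnk_gen n k) -> Prop :=
| gnk_block_pair (r1 r2 : gnk_gen n k) : #|sval r1 :&: sval r2| < k.-1 ->
    gnk_block [:: r1; r2]
| gnk_block_facets (U : {set 'I_n}) (u : 'I_k.+1 -> 'I_n)
    (r : 'I_k.+1 -> gnk_gen n k) :
    #|U| = k.+1 -> U = [set u j | j : 'I_k.+1] ->
    (forall j, sval (r j) = U :\ u j) ->
    gnk_block [seq r j | j <- enum 'I_k.+1].

Lemma gnk_sq1 x : pres_eq (@gnk_rel n k) (wpos [:: x; x]) (wpos [::]).
Proof. by apply: pres_eq_rel; exact: gnk_sq. Qed.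

(** [u] is injective because it enumerates a set of [k.+1] elements, and the
    facet [U :\ u j] determines [u j]. *)
Lemma gnk_block_uniq s : gnk_block s -> uniq s.
Proof.
case=> [r1 r2|U u r cU Uu rU].
  rewrite /= inE andbT; case: eqP => // ->.
  by rewrite finset.setIid (eqP (svalP r2)) ltnNge leq_pred.
have inj_u : injective u.
  have /imset_injP inj : #|[set u j | j : 'I_k.+1]| == #|'I_k.+1|.
    by rewrite -Uu cU card_ord.
  by move=> i j; exact: inj.
rewrite map_inj_uniq ?enum_uniq // => i j rij; apply: inj_u.
have ui : u i \in U by rewrite Uu imset_f.
have := in_setD1 (u i) U (u i); rewrite eqxx /= -rU rij rU in_setD1 ui andbT.
by move/eqP.
Qed.

Lemma gnk_block_size s : gnk_block s -> 1 < size s.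
Proof. by case=> // U u r _ _ _; rewrite size_map size_enum_ord. Qed.

Lemma gnk_block_reversible s : ordering gnk_block s -> reversible (@gnk_rel n k) s.
Proof.
case=> _ [r1 r2 r12|U u r cU Uu rU] p.
  have rev_r12 : reversible (@gnk_rel n k) [:: r1; r2].
    by apply: pres_eq_rel; exact: gnk_comm.
  by case: (perm_eq_pair p) => -> //; exact: reversible_rev rev_r12.
(* An ordering of the facets is again an enumeration by a permutation. *)
move: p; rewrite perm_sym.
rewrite -[X in perm_eq _ X]/(tval [tuple of [seq r j | j <- ord_tuple k.+1]]).
case/tuple_permP=> g ->; apply: pres_eq_rel.
have -> : tval [tuple tnth [tuple of [seq r j | j <- ord_tuple k.+1]] (g i)
               | i < k.+1]
    = [seq r (g i) | i <- enum 'I_k.+1].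
  by apply: eq_map => i; rewrite tnth_map tnth_ord_tuple.
exact: gnk_rev cU Uu rU.
Qed.

Lemma gnk_coxeter : exists C, isomorphic (coxeter_group C) (Gnk n k).
Proof.
exists (block_weighted gnk_block).
apply: block_coxeter_group; [exact: gnk_block_uniq | exact: gnk_block_size
  | exact: gnk_sq1 | exact: gnk_block_reversible |].
move=> u v [r|r1 r2 r12|U w r g cU Uw rU]; [left | right | right].
- by exists r.
- exists [:: r1; r2]; split=> //.
  by exists [:: r1; r2] => //; constructor.
- exists [seq r (g i) | i <- enum 'I_k.+1]; split=> //.
  exists [seq r (g i) | i <- enum 'I_k.+1] => //.
  apply: (@gnk_block_facets U (w \o g) (r \o g)) => //=.
  rewrite Uw; apply/finset.setP=> x; apply/imsetP/imsetP => -[j _ ->].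
    by exists (g^-1 j)%g; rewrite //= permKV.
  by exists (g j).
Qed.

End GnkBlocks.

Theorem mainTheorem2 :
  (forall n : nat, 0 < n ->
     exists C : weighted_complex2, isomorphic (coxeter_group C) (GVP n)) /\
  (forall n k : nat, 0 < n -> 0 < k ->
     exists C : weighted_complex2, isomorphic (coxeter_group C) (Gnk n k)).
Proof.
split=> [n _|n k _ k_gt0]; first exact: gvp_coxeter.
exact: gnk_coxeter.
Qed.
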